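(* Let $p\ge 2$ and $\square=(-1,1)^2$. For $2\le i,j\le p$ define the vector fields on $\square$ $$v^{I}_{ij}=\begin{pmatrix}L_{i-1}(x)\hat L_j(y)\\ \hat L_i(x)L_{j-1}(y)\end{pmatrix},\quad v^{II}_{ij}=\begin{pmatrix}L_{i-1}(x)\hat L_j(y)\\ -\hat L_i(x)L_{j-1}(y)\end{pmatrix},\quad v^{III}_i=\begin{pmatrix}\hat L_i(y)\\0\end{pmatrix},\quad v^{III}_{i+p}=\begin{pmatrix}0\\-\hat L_i(x)\end{pmatrix}.$$ Let $$\tilde b^{I}_{kl}=\begin{pmatrix}L_{k-1}(x)P^{(1,1)}_{l-2}(y)\\0\end{pmatrix}\ (1\le k\le p,\ 2\le l\le p),\qquad \tilde b^{II}_{kl}=\begin{pmatrix}0\\P^{(1,1)}_{k-2}(x)L_{l-1}(y)\end{pmatrix}\ (2\le k\le p,\ 1\le l\le p),$$ and $\alpha_{kl}=\frac18 k(2k-1)(2l-1)$. Then the functions, for $2\le k,l\le p$, $$b^{I}_{kl}=\alpha_{lk}\,\tilde b^{I}_{kl}+\alpha_{kl}\,\tilde b^{II}_{kl},\qquad b^{II}_{kl}=\alpha_{lk}\,\tilde b^{I}_{kl}-\alpha_{kl}\,\tilde b^{II}_{kl},\qquad b^{III}_{l}=\tilde b^{I}_{1l},\qquad b^{III}_{l+p}=\tilde b^{II}_{l1}$$ are biorthogonal to the functions $v^{I}_{ij},v^{II}_{ij},v^{III}_i,v^{III}_{i+p}$ ($2\le i,j\le p$). That is, with respect to the $L^2(\square)^2$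 inner product, each $v$-function is orthogonal to every $b$-function except the one with the same type and the same index (or index pair), and the inner product with that one is nonzero.
   Context: $P_n^{(\alpha,\beta)}$ is the classical Jacobi polynomial of degree $n$ (orthogonal on $(-1,1)$ for the weight $(1-x)^\alpha(1+x)^\beta$, standard Rodrigues normalization $P_n^{(\alpha,\beta)}(x)=\frac{1}{2^n n!(1-x)^\alpha(1+x)^\beta}\frac{d^n}{dx^n}[(1-x)^\alpha(1+x)^\beta(x^2-1)^n]$). $L_n=P_n^{(0,0)}$ is the Legendre polynomial and $\hat L_n(x)=\int_{-1}^xL_{n-1}(t)\,dt$ the integrated Legendre polynomial. $\langle v,w\rangle=\int_\square v\cdot w\,dx\,dy$. *)

(* Defs.v *)
From HB Require Import structures.
From mathcomp Require Import all_boot all_order all_algebra.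
From mathcomp Require Import all_classical all_reals all_analysis.
From mathcomp Require Import ring.
Import Order.TTheory GRing.Theory Num.Theory.
Import numFieldNormedType.Exports.
Set Implicit Arguments.
Unset Strict Implicit.
Unset Printing Implicit Defensive.
Local Open Scope classical_set_scope.
Local Open Scope ring_scope.

(* Jacobi polynomial P_n^(a,b) for natural parameters, by Rodrigues' formula;
   the polynomial division is exact, see [jacobi_rodrigues]. *)
Definition jacobi_weight (R : realType) (a b : nat) : {poly R} :=
  (1 - 'X) ^+ a * (1 + 'X) ^+ b.

Definition jacobi (R : realType) (a b n : nat) : {poly R} :=
  ((jacobi_weight R a b * ('X ^+ 2 - 1) ^+ n)^`(n))
    %/ ((2 ^ n * n`!)%:R%:P * jacobi_weight R a b).

Lemma dvdp_derivn (R : realType) (a b n : nat) (u v q : {poly R}) :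
  u ^+ a * v ^+ b %| (u ^+ (a + n) * v ^+ (b + n) * q)^`(n).
Proof.
elim: n q => [|n IH] q; first by rewrite !addn0 derivn0 dvdp_mulr.
rewrite derivSn !addnS.
suff -> : (u ^+ (a + n).+1 * v ^+ (b + n).+1 * q)^`() =
    u ^+ (a + n) * v ^+ (b + n) *
      ((u^`() * v * q) *+ (a + n).+1 + (u * v^`() * q) *+ (b + n).+1
       + u * v * q^`()) by exact: IH.
rewrite !derivM !deriv_exp /= !exprS.
ring.
Qed.

Lemma derive1n_horner (R : realType) (n : nat) (p : {poly R}) :
  derive1n n (horner p) = horner p^`(n).
Proof.
elim: n => [|n IH]; first by rewrite derive1n0 derivn0.
rewrite derive1nS IH derivnS; apply/funext => x.
by rewrite derivE.
Qed.

Lemma jacobi_rodrigues (R : realType) (a b n : nat) (x : R) : x \in `]-1, 1[ ->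
  (jacobi R a b n).[x] =
    ((2 ^ n * n`!)%:R * (1 - x) ^+ a * (1 + x) ^+ b)^-1 *
    derive1n n (fun t : R => (1 - t) ^+ a * (1 + t) ^+ b * (t ^+ 2 - 1) ^+ n) x.
Proof.
rewrite in_itv /= => /andP[x1 x2].
have c0 : (2 ^ n * n`!)%:R != 0 :> R by rewrite pnatr_eq0 -lt0n muln_gt0 expn_gt0 fact_gt0.
have u0 : 1 - x != 0 by rewrite subr_eq0 gt_eqF.
have v0 : 1 + x != 0 by rewrite addrC -(opprK 1) subr_eq0 gt_eqF.
set p : {poly R} := jacobi_weight R a b * ('X ^+ 2 - 1) ^+ n.
have -> : (fun t : R => (1 - t) ^+ a * (1 + t) ^+ b * (t ^+ 2 - 1) ^+ n) = horner p.
  by apply/funext => t; rewrite /p /jacobi_weight !hornerE.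
rewrite derive1n_horner.
have dv : (2 ^ n * n`!)%:R%:P * jacobi_weight R a b %| p^`(n).
  rewrite mul_polyC dvdpZl // /jacobi_weight.
  suff -> : p = (1 - 'X) ^+ (a + n) * (1 + 'X) ^+ (b + n) * (-1) ^+ n.
    exact: dvdp_derivn.
  rewrite /p /jacobi_weight !exprD -!mulrA; congr (_ * _).
  rewrite mulrCA; congr (_ * _).
  by rewrite -!exprMn; congr (_ ^+ _); ring.
have := congr1 (horner^~ x) (divpK dv).
rewrite -/(jacobi R a b n) => <-.
have ev : ((2 ^ n * n`!)%:R%:P * jacobi_weight R a b).[x] =
    (2 ^ n * n`!)%:R * (1 - x) ^+ a * (1 + x) ^+ b.
  by rewrite mul_polyC hornerZ /jacobi_weight !hornerE.
by rewrite hornerM ev mulrC mulfK // !mulf_neq0 // expf_neq0.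
Qed.

Definition legendre (R : realType) (n : nat) : {poly R} := jacobi R 0 0 n.

(* Meant for n >= 1. *)
Definition int_legendre (R : realType) (n : nat) (x : R) : R :=
  \int[lebesgue_measure]_(t in `[-1, x]) (legendre R n.-1).[t].

Definition square (R : realType) : set (R * R) := `]-1, 1[ `*` `]-1, 1[.

Definition L2inner (R : realType) (v w : R * R -> R * R) : R :=
  \int[(lebesgue_measure \x lebesgue_measure)%E]_(z in @square R)
    ((v z).1 * (w z).1 + (v z).2 * (w z).2).

(* [TypeIII i] covers both families v^III_i (2 <= i <= p) and v^III_{i+p}. *)
Inductive family_index := TypeI of nat & nat | TypeII of nat & nat | TypeIII of nat.

Definition index_in (p : nat) (s : family_index) : bool :=
  match s with
  | TypeI i j | TypeII i j => (2 <= i <= p) && (2 <= j <= p)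
  | TypeIII i => (2 <= i <= p) || (p + 2 <= i <= p + p)
  end%N.

Definition v_fun (R : realType) (p : nat) (s : family_index) : R * R -> R * R :=
  fun z => let (x, y) := z in
  match s with
  | TypeI i j => ((legendre R i.-1).[x] * int_legendre j y,
              int_legendre i x * (legendre R j.-1).[y])
  | TypeII i j => ((legendre R i.-1).[x] * int_legendre j y,
               - (int_legendre i x * (legendre R j.-1).[y]))
  | TypeIII i => if (i <= p)%N then (int_legendre i y, 0)
             else (0, - int_legendre (i - p) x)
  end.

Definition btilde_I (R : realType) (k l : nat) : R * R -> R * R :=
  fun z => ((legendre R k.-1).[z.1] * (jacobi R 1 1 (l - 2)).[z.2], 0).

Definition btilde_II (R : realType) (k l : nat) : R * R -> R * R :=
  fun z => (0, (jacobi R 1 1 (k - 2)).[z.1] * (legendre R l.-1).[z.2]).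

Definition alpha (R : realType) (k l : nat) : R :=
  8^-1 * k%:R * (2 * k%:R - 1) * (2 * l%:R - 1).

Definition lincomb (R : realType) (c d : R) (v w : R * R -> R * R) :
    R * R -> R * R :=
  fun z => (c * (v z).1 + d * (w z).1, c * (v z).2 + d * (w z).2).

Definition b_fun (R : realType) (p : nat) (s : family_index) : R * R -> R * R :=
  match s with
  | TypeI k l => lincomb (alpha R l k) (alpha R k l)
               (@btilde_I R k l) (@btilde_II R k l)
  | TypeII k l => lincomb (alpha R l k) (- alpha R k l)
                (@btilde_I R k l) (@btilde_II R k l)
  | TypeIII l => if (l <= p)%N then @btilde_I R 1 l else @btilde_II R (l - p) 1
  end.

(* Main.v *)
Require Import Defs.
From HB Require Import structures.
From mathcomp Require Import all_boot all_order all_algebra.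
From mathcomp Require Import all_classical all_reals all_analysis.
From mathcomp Require Import measurable_realfun.
From mathcomp Require Import ring lra zify.
Import Order.TTheory GRing.Theory Num.Theory.
Import numFieldNormedType.Exports.
Set Implicit Arguments.
Unset Strict Implicit.
Unset Printing Implicit Defensive.
Local Open Scope classical_set_scope.
Local Open Scope ring_scope.

(** With w = X^2 - 1, Rodrigues' formula for the symmetric Jacobi polynomials
    reads w^a P_n^(a,a) = (2^n n!)^-1 (w^(n+a))^(n) ([mul_w_jacobi]). As w^m and
    its first m-1 derivatives vanish at -1 and 1, integrating by parts n times
    moves all the derivatives onto the other factor
    ([polyint_jacobi_parts]). If that factor has degree less than n the integral
    is zero: the P_n^(a,a) are orthogonal for the weight w^a
    ([jacobi_orthogonal]). If it is P_n^(a,a) itself, only its leading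
    coefficient and the integral of w^(n+a) remain, which gives the norm
    ([jacobi_norm]).

    The case a = 0 gives the integral of L_m L_n. For a = 1, the formula also
    shows that the integrated Legendre polynomial of degree n is
    w P_(n-2)^(1,1) / (2 (n - 1)) ([int_legendreE]), so its integral against
    P_(l-2)^(1,1) is -4 / (l (2l - 1)) when n = l and 0 otherwise.

    Every v-function is of the form
      (e1 L_(i-1)(x) Lhat_j(y), e2 Lhat_i(x) L_(j-1)(y))
    and every b-function of the form
      (f1 L_(k-1)(x) P_(l-2)(y), f2 P_(k-2)(x) L_(l-1)(y)),
    with P_n for P_n^(1,1). By Fubini's theorem their inner product is
    e1 f1 I(i,j,k,l) + e2 f2 I(j,i,l,k), where I is the product of two of the
    above integrals ([L2inner_pairing]). The factor alpha_lk is such that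
    alpha_lk I(i,j,k,l) = - delta_ik delta_jl ([alpha_pairing]): for the first
    two families the two terms add up to -2 when the types agree and cancel when
    they differ. The third family has i = 1 or j = 1, hence it is orthogonal to
    the first two because L_0 is orthogonal to L_n for n >= 1. Within the third
    family, functions directed along different axes are pointwise orthogonal,
    and the others reduce to a single value of I. *)

(** * Integrals of tensor products *)

Section tensor_integral.
Context d1 d2 (T1 : measurableType d1) (T2 : measurableType d2) (R : realType).
Variable m1 : {sigma_finite_measure set T1 -> \bar R}.
Variable m2 : {sigma_finite_measure set T2 -> \bar R}.
Variables (A : set T1) (B : set T2) (f : T1 -> R) (g : T2 -> R).
Hypotheses (mA : measurable A) (mB : measurable B).
Hypothesis intf : m1.-integrable A (EFin \o f).
Hypothesis intg : m2.-integrable B (EFin \o g).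

Let f' := f \_ A.
Let g' := g \_ B.

Let intf' : m1.-integrable setT (EFin \o f').
Proof. by move: intf => /(integrable_mkcond _ mA); rewrite restrict_EFin. Qed.

Let intg' : m2.-integrable setT (EFin \o g').
Proof. by move: intg => /(integrable_mkcond _ mB); rewrite restrict_EFin. Qed.

Let tensor_restrict :
  (fun z : T1 * T2 => f z.1 * g z.2) \_ (A `*` B) = fun z => f' z.1 * g' z.2.
Proof.
apply/funext => -[x y]; rewrite /f' /g' !patchE /= in_setX /=.
by case: (x \in A); case: (y \in B); rewrite /= ?mul0r ?mulr0.
Qed.

Let int_tensor' : (m1 \x m2)%E.-integrable setT (EFin \o (fun z => f' z.1 * g' z.2)).
Proof.
have mf : measurable_fun setT f' by exact/measurable_EFinP/(measurable_int m1).
have mg : measurable_fun setT g' by exact/measurable_EFinP/(measurable_int m2).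
apply/integrable12ltyP.
  apply/measurable_EFinP; apply: measurable_funM.
    exact: measurableT_comp.
  exact: measurableT_comp.
under eq_integral => x _.
  under eq_integral => y _ do rewrite /= normrM EFinM.
  rewrite ge0_integralZl//; last exact/measurable_EFinP/measurableT_comp.
  over.
rewrite /= ge0_integralZr//.
- apply: lte_mul_pinfty; first exact: integral_ge0.
  + have /integrable_norm/(integrable_fin_num measurableT) := intf'.
    exact.
  + by have /integrableP[] := intg'.
- exact/measurable_EFinP/measurableT_comp.
- exact: integral_ge0.
Qed.

Lemma integrable_tensor :
  (m1 \x m2)%E.-integrable (A `*` B) (EFin \o (fun z => f z.1 * g z.2)).
Proof.
apply/integrable_mkcond; first exact: measurableX.
by rewrite restrict_EFin tensor_restrict.
Qed.

Lemma Rintegral_tensor :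
  \int[(m1 \x m2)%E]_(z in A `*` B) (f z.1 * g z.2) =
  \int[m1]_(x in A) f x * \int[m2]_(y in B) g y.
Proof.
rewrite Rintegral_mkcond tensor_restrict.
rewrite [X in X * _]Rintegral_mkcond [X in _ * X]Rintegral_mkcond -/f' -/g'.
rewrite /Rintegral -(integral12_prod_meas1 int_tensor') /fubini_F /=.
rewrite -fineM; [|exact: integrable_fin_num..]; congr fine.
under eq_integral => x _.
  under eq_integral => y _ do rewrite EFinM.
  rewrite integralZl//; over.
rewrite /= -(fineK (integrable_fin_num measurableT intg')).
by rewrite integralZr.
Qed.

End tensor_integral.

(** * Integration of polynomials over the interval (-1, 1) *)

Section polyint.
Variable R : realType.
Implicit Types (p q : {poly R}) (n m k a : nat).

(** The integral of a polynomial over (-1, 1). *)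
Definition polyint p : R := \int[lebesgue_measure]_(x in `]-1, 1[) p.[x].

Lemma integrable_horner p (a b : R) (b1 b2 : bool) :
  lebesgue_measure.-integrable [set` Interval (BSide b1 a) (BSide b2 b)]
    (EFin \o horner p).
Proof.
apply: (@integrableS _ _ _ lebesgue_measure `[a, b]%classic) => //.
  by apply: subset_itvScc; [case: b1|case: b2]; rewrite bnd_simp.
apply: continuous_compact_integrable; first exact: segment_compact.
exact/continuous_subspaceT/continuous_horner.
Qed.

Lemma polyintD p q : polyint (p + q) = polyint p + polyint q.
Proof.
rewrite /polyint -RintegralD//; [|exact: integrable_horner..].
by apply: eq_Rintegral => x _; rewrite hornerD.
Qed.

Lemma polyintZ (c : R) p : polyint (c *: p) = c * polyint p.
Proof.
rewrite /polyint -RintegralZl//; last exact: integrable_horner.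
by apply: eq_Rintegral => x _; rewrite hornerZ.
Qed.

Lemma polyintZZ (c d : R) p q :
  polyint ((c *: p) * (d *: q)) = c * d * polyint (p * q).
Proof. by rewrite -scalerAl -scalerAr !polyintZ mulrA. Qed.

Lemma Rintegral_deriv_horner p (a b : R) : a < b ->
  \int[lebesgue_measure]_(x in `[a, b]) p^`().[x] = p.[b] - p.[a].
Proof.
move=> ab; rewrite /Rintegral (@continuous_FTC2 _ _ (horner p))//.
- exact/continuous_subspaceT/continuous_horner.
- split; first by move=> x _; exact: derivable_horner.
    exact/cvg_at_right_filter/continuous_horner.
  exact/cvg_at_left_filter/continuous_horner.
- by move=> x _; rewrite derivE.
Qed.

Lemma polyint_deriv p : polyint p^`() = p.[1] - p.[-1].
Proof.
rewrite -Rintegral_deriv_horner; last lra.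
rewrite /polyint Rintegral_itv_obnd_cbnd; last exact: integrable_horner.
by rewrite Rintegral_itv_bndo_bndc//; exact: integrable_horner.
Qed.

Lemma polyint_parts p q : p.[1] = 0 -> p.[-1] = 0 ->
  polyint (p^`() * q) = - polyint (p * q^`()).
Proof.
move=> p1 pN1; apply/eqP; rewrite -addr_eq0 -polyintD -derivM polyint_deriv.
by rewrite !hornerM p1 pN1 !mul0r subrr.
Qed.

(** * Powers of X^2 - 1 and their derivatives *)

Local Notation w := ('X^2 - 1 : {poly R}).

Lemma monic_w : w \is monic.
Proof. exact: monic_Xn_sub_1. Qed.

Lemma size_w_exp n : size (w ^+ n) = (2 * n).+1.
Proof.
have /monic_neq0 := monic_exp n monic_w; rewrite -size_poly_gt0 => /prednK <-.
by rewrite size_exp -[1]/(1%:P) size_XnsubC.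
Qed.

(** The points of vanishing are -1 and 1, roots of multiplicity m of w ^+ m. *)
Lemma root_derivn_w m k (x : R) : (k < m)%N -> x ^+ 2 = 1 ->
  ((w ^+ m)^`(k)).[x] = 0.
Proof.
move=> km x2.
have := @dvdp_derivn R (m - k) 0 k w 1 1.
rewrite expr0 expr1n !mulr1 subnK 1?ltnW// => /dvdpP[q ->].
by rewrite hornerM horner_exp !hornerE x2 subrr expr0n subn_eq0 leqNgt km mulr0.
Qed.

Lemma polyint_parts_w m k (q : {poly R}) : (k <= m)%N ->
  polyint ((w ^+ m)^`(k) * q) = (- 1) ^+ k * polyint (w ^+ m * q^`(k)).
Proof.
elim: k q => [|k IH] q km; first by rewrite !derivn0 expr0 mul1r.
rewrite derivnS polyint_parts ?root_derivn_w ?sqrrN ?expr1n// IH 1?ltnW//.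
by rewrite -derivSn [(- 1) ^+ k.+1]exprS mulN1r mulNr.
Qed.

(** By induction on n: the derivative of X w^(n+1), which vanishes at -1 and 1,
    is (2n + 3) w^(n+1) + (2n + 2) w^n. *)
Lemma polyint_w n :
  polyint (w ^+ n) = (- 1) ^+ n * 2 * (2 ^ n * n`!)%:R ^+ 2 / (2 * n).+1`!%:R.
Proof.
elim: n => [|n IH].
  rewrite expr0 -(derivX R) polyint_deriv !hornerX !expr0 muln0 expn0 fact0.
  by rewrite expr1n -[1`!]/1%N divr1; lra.
have ibp : (2 * n%:R + 3) * polyint (w ^+ n.+1) =
    - (2 * n%:R + 2) * polyint (w ^+ n).
  have : polyint ('X * w ^+ n.+1)^`() = 0.
    rewrite polyint_deriv !hornerM !horner_exp !hornerE sqrrN expr1n subrr.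
    by rewrite expr0n !mulr0 subr0.
  have -> : ('X * w ^+ n.+1)^`() =
      (2 * n%:R + 3) *: w ^+ n.+1 + (2 * n%:R + 2) *: w ^+ n.
    rewrite -!mul_polyC derivM derivX deriv_exp derivB derivXn derivC /= exprS.
    rewrite !raddfD/= !rmorphM/= !rmorph_nat -mulr_natl; ring.
  by rewrite polyintD !polyintZ mulNr => /eqP; rewrite addr_eq0 => /eqP.
have n3 : 2 * n%:R + 3 != 0 :> R by rewrite -natrM -natrD pnatr_eq0 addn3.
have n2 : 2 * n%:R + 2 != 0 :> R by rewrite -natrM -natrD pnatr_eq0 addn2.
have f0 : (2 * n).+1`!%:R != 0 :> R by rewrite pnatr_eq0 -lt0n fact_gt0.
have fE : (2 * n.+1).+1`!%:R =
    (2 * n%:R + 3) * (2 * n%:R + 2) * (2 * n).+1`!%:R :> R.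
  by rewrite mulnS add2n !(factS _.+1) !natrM -!natr1 natrM; ring.
have gE : (2 ^ n.+1 * n.+1`!)%:R = (2 * n%:R + 2) * (2 ^ n * n`!)%:R :> R.
  by rewrite expnS factS !natrM -natr1; ring.
apply: (mulfI n3); rewrite ibp IH fE gE [(- 1) ^+ n.+1]exprS.
by field; rewrite n3 n2 f0.
Qed.

(** * Orthogonality and norm of symmetric Jacobi polynomials *)

Lemma size_derivn_w m n : (n <= 2 * m)%N ->
  size ((w ^+ m)^`(n)) = (2 * m - n).+1.
Proof.
move=> nm; apply/eqP; rewrite eqn_leq; apply/andP; split.
  apply/leq_sizeP => j mj; rewrite coef_derivn nth_default ?mul0rn//.
  by rewrite size_w_exp -(subnKC nm) -addnS leq_add2l.
rewrite ltnNge; apply/negP => /leq_sizeP /(_ _ (leqnn _)) /eqP.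
rewrite coef_derivn subnKC// -[X in _`_X](_ : (size (w ^+ m)).-1 = _).
  have /monicP := monic_exp m monic_w; rewrite /lead_coef => ->.
  by rewrite pnatr_eq0 -leqn0 leqNgt ffact_gt0 nm.
by rewrite size_w_exp.
Qed.

Lemma lead_coef_derivn_w m n : (n <= 2 * m)%N ->
  lead_coef ((w ^+ m)^`(n)) = ((2 * m) ^_ n)%:R.
Proof.
move=> nm; rewrite lead_coefE size_derivn_w//= coef_derivn subnKC//.
have /monicP := monic_exp m monic_w.
by rewrite lead_coefE size_w_exp => ->.
Qed.

Lemma rodrigues_cst_neq0 n : (2 ^ n * n`!)%:R != 0 :> R.
Proof. by rewrite pnatr_eq0 -lt0n muln_gt0 expn_gt0 fact_gt0. Qed.

(** Rodrigues' formula without the division: the weight (1-X)^a (1+X)^a equals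
    (-1)^a w^a, and the sign cancels. *)
Lemma mul_w_jacobi a n :
  w ^+ a * jacobi R a a n = (2 ^ n * n`!)%:R^-1 *: (w ^+ (n + a))^`(n).
Proof.
have c0 := rodrigues_cst_neq0 n.
have WE : jacobi_weight R a a = (- 1) ^+ a *: w ^+ a.
  rewrite /jacobi_weight -!exprMn -exprZn; congr (_ ^+ a).
  by rewrite scaleN1r; ring.
have s0 : (- 1) ^+ a != 0 :> R by rewrite signr_eq0.
have dv : (2 ^ n * n`!)%:R%:P * jacobi_weight R a a %|
    (jacobi_weight R a a * w ^+ n)^`(n).
  rewrite mul_polyC dvdpZl// WE -scalerAl derivnZ dvdpZl// dvdpZr// -exprD addnC.
  by have := @dvdp_derivn R a 0 n w 1 1; rewrite !expr1n !mulr1 addnC.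
have := divpK dv; rewrite -/(jacobi R a a n).
rewrite mul_polyC WE -scalerAl derivnZ -exprD scalerA -scalerAr.
rewrite [_%:R * _]mulrC -scalerA => /(scalerI s0).
by rewrite [(n + a)%N]addnC => <-; rewrite scalerA mulVf// scale1r mulrC.
Qed.

Lemma size_jacobi a n : size (jacobi R a a n) = n.+1.
Proof.
have c0 := rodrigues_cst_neq0 n.
have nm : (n <= 2 * (n + a))%N by lia.
have sz := congr1 (fun p : {poly R} => size p) (mul_w_jacobi a n).
rewrite /= size_scale ?invr_eq0// size_derivn_w// in sz.
have q0 : jacobi R a a n != 0.
  by apply/eqP => q0; rewrite q0 mulr0 size_poly0 in sz.
rewrite size_monicM// ?monic_exp ?monic_w// size_w_exp in sz.
move: sz; set s := size _; lia.
Qed.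

Lemma lead_coef_jacobi a n :
  lead_coef (jacobi R a a n) = ((2 * (n + a)) ^_ n)%:R / (2 ^ n * n`!)%:R.
Proof.
rewrite -(lead_coef_monicM _ (monic_exp a monic_w)) mul_w_jacobi lead_coefZ.
by rewrite lead_coef_derivn_w 1?mulrC//; lia.
Qed.

Lemma polyint_jacobi_parts a n q :
  polyint (w ^+ a * jacobi R a a n * q) =
  (2 ^ n * n`!)%:R^-1 * ((- 1) ^+ n * polyint (w ^+ (n + a) * q^`(n))).
Proof.
by rewrite mul_w_jacobi -scalerAl polyintZ polyint_parts_w// leq_addr.
Qed.

Lemma jacobi_orthogonal a m n : m != n ->
  polyint (w ^+ a * jacobi R a a m * jacobi R a a n) = 0.
Proof.
wlog nm : m n / (n < m)%N => [H mn|_].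
  have [/H->//|nm|mn'] := ltngtP n m.
    by rewrite -mulrA [X in _ * X]mulrC mulrA H// eq_sym.
  by rewrite mn' eqxx in mn.
rewrite polyint_jacobi_parts derivn_poly0 ?size_jacobi//.
by rewrite mulr0 -(scale0r 0) polyintZ mul0r !mulr0.
Qed.

(** The sign (-1)^a is there because the weight w^a has that sign on (-1, 1). *)
Lemma jacobi_norm a n :
  polyint (w ^+ a * jacobi R a a n * jacobi R a a n) =
  (- 1) ^+ a * 2 / (2 * (n + a)).+1%:R *
  ((2 ^ (n + a) * (n + a)`!)%:R / (2 ^ n * n`!)%:R) ^+ 2 *
  (n`!%:R / (n + 2 * a)`!%:R).
Proof.
rewrite polyint_jacobi_parts.
(* the n-th derivative of a polynomial of degree n is a constant *)
have -> : (jacobi R a a n)^`(n) = (lead_coef (jacobi R a a n) * n`!%:R)%:P.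
  rewrite [LHS]size1_polyC; last first.
    apply/leq_sizeP => j j0; rewrite coef_derivn nth_default ?mul0rn//.
    by rewrite size_jacobi; lia.
  by rewrite coef_derivn addn0 ffactnn lead_coefE size_jacobi mulr_natr.
rewrite mulrC -[X in _ * polyint X]mulrC mul_polyC polyintZ polyint_w.
rewrite lead_coef_jacobi.
have nm : (n <= 2 * (n + a))%N by lia.
have -> : (2 * (n + a)).+1`!%:R =
    (2 * (n + a)).+1%:R * (((2 * (n + a)) ^_ n)%:R * (n + 2 * a)`!%:R) :> R.
  rewrite -!natrM factS -(ffact_fact nm).
  by rewrite (_ : (2 * (n + a) - n = n + 2 * a)%N)//; lia.
have := rodrigues_cst_neq0 n.
have f0 k : k`!%:R != 0 :> R by rewrite pnatr_eq0 -lt0n fact_gt0.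
rewrite exprD; set c := (2 ^ n * _)%:R => c0.
have ss : (- 1) ^+ n * (- 1) ^+ n = 1 :> R by rewrite -expr2 sqrr_sign.
have nf0 : ((2 * (n + a)) ^_ n)%:R != 0 :> R by rewrite pnatr_eq0 -lt0n ffact_gt0.
have n1 : (2 * (n + a)).+1%:R != 0 :> R by rewrite pnatr_eq0.
rewrite -[RHS]mul1r -[X in _ = X * _]ss.
field; rewrite !f0 nf0 pnatr_eq0 expn_eq0 /=.
by rewrite -natrD -natrM nat1r pnatr_eq0.
Qed.

(** * Legendre and integrated Legendre polynomials *)

Lemma legendre_moment m n :
  polyint (legendre R m * legendre R n) = (m == n)%:R * (2 / (2 * n%:R + 1)).
Proof.
have [->|mn] := eqVneq m n; last first.
  by rewrite mul0r -[X in polyint (X * _)]mul1r (jacobi_orthogonal 0 mn).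
have c0 := rodrigues_cst_neq0 n.
have f0 : n`!%:R != 0 :> R by rewrite pnatr_eq0 -lt0n fact_gt0.
have := jacobi_norm 0 n; rewrite expr0 mul1r => ->.
rewrite expr0 muln0 !addn0 (divff c0) (divff f0).
by rewrite expr1n !mulr1 !mul1r -[(2 * n).+1%:R]natr1 natrM.
Qed.

Lemma jacobi11_moment m n :
  polyint (w * jacobi R 1 1 m * jacobi R 1 1 n) =
  (m == n)%:R * (- (8 * (n%:R + 1)) / ((2 * n%:R + 3) * (n%:R + 2))).
Proof.
have [->|mn] := eqVneq m n; last by rewrite mul0r (jacobi_orthogonal 1 mn).
have := jacobi_norm 1 n; rewrite !expr1 mul1r => ->.
have c0 := rodrigues_cst_neq0 n.
have f0 : n`!%:R != 0 :> R by rewrite pnatr_eq0 -lt0n fact_gt0.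
have gE : (2 ^ (n + 1) * (n + 1)`!)%:R = (2 * n%:R + 2) * (2 ^ n * n`!)%:R :> R.
  by rewrite addn1 expnS factS !natrM -natr1; ring.
have n1 : n%:R + 1 != 0 :> R by rewrite natr1 pnatr_eq0.
have n2 : n%:R + 2 != 0 :> R by rewrite -natrD pnatr_eq0 addn2.
have n3 : 2 * n%:R + 3 != 0 :> R by rewrite -natrM -natrD pnatr_eq0 addn3.
rewrite gE mulfK// muln1 addn2 !factS !natrM.
rewrite -[(2 * (n + 1)).+1%:R]natr1 -[n.+2%:R]natr1 -[n.+1%:R]natr1.
rewrite natrM natrD.
by field; rewrite n2 n3 f0 n1.
Qed.

(** The integrated Legendre polynomial of degree n, for 2 <= n, as a polynomial.
    For n = 1 the inverse of zero makes it 0, which is not the integral of L_0. *)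
Definition int_legendre_poly n : {poly R} :=
  (2 * n.-1%:R)^-1 *: (w * jacobi R 1 1 (n - 2)).

Lemma int_legendreE n (x : R) : (2 <= n)%N -> -1 < x ->
  int_legendre n x = (int_legendre_poly n).[x].
Proof.
case: n => [|[|n]]// _ x1; rewrite /int_legendre /int_legendre_poly /= subn2 /=.
have c0 := rodrigues_cst_neq0 n.
have -> : legendre R n.+1 = ((2 * n.+1%:R)^-1 *: (w * jacobi R 1 1 n))^`().
  have := mul_w_jacobi 0 n.+1; rewrite expr0 mul1r addn0 /legendre => ->.
  have := mul_w_jacobi 1 n; rewrite expr1 addn1 => ->.
  rewrite scalerA derivZ -derivnS; congr (_ *: _).
  by rewrite expnS factS mulnACA !natrM invfM -!natrM.
rewrite Rintegral_deriv_horner//.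
rewrite [X in _ - X](_ : _ = 0) ?subr0//.
rewrite hornerZ hornerM (_ : w.[-1] = 0) ?mul0r ?mulr0//.
by rewrite !hornerE sqrrN expr1n subrr.
Qed.

Lemma int_legendre_moment m n : (2 <= m)%N -> (2 <= n)%N ->
  polyint (int_legendre_poly m * jacobi R 1 1 (n - 2)) =
  (m == n)%:R * (- 4 / (n%:R * (2 * n%:R - 1))).
Proof.
case: m => [|[|m]]//; case: n => [|[|n]]// _ _.
rewrite /int_legendre_poly -scalerAl polyintZ !subn2 /= jacobi11_moment.
rewrite !eqSS; have [->|_] := eqVneq m n; last by rewrite !mul0r mulr0.
have n1 : n.+1%:R != 0 :> R by rewrite pnatr_eq0.
have n2 : n%:R + 2 != 0 :> R by rewrite -natrD pnatr_eq0 addn2.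
have n3 : 2 * n%:R + 3 != 0 :> R by rewrite -natrM -natrD pnatr_eq0 addn3.
move: n1; rewrite -[n.+2%:R]natr1 -[n.+1%:R]natr1 => n1.
field; rewrite n1 (_ : n%:R + 1 + 1 = n%:R + 2) ?n2; last ring.
by rewrite (_ : _ - 1 = 2 * n%:R + 3) ?n3//; ring.
Qed.

End polyint.

(** * Inner products of the two families of vector fields *)

(** The bounds in the first hypothesis are needed because the integrated
    Legendre functions are polynomials only to the right of -1. *)
Lemma L2inner_horner (R : realType) (v b : R * R -> R * R)
    (v1 v2 v3 v4 b1 b2 b3 b4 : {poly R}) :
  (forall x y : R, -1 < x -> -1 < y ->
    v (x, y) = (v1.[x] * v2.[y], v3.[x] * v4.[y])) ->
  (forall x y, b (x, y) = (b1.[x] * b2.[y], b3.[x] * b4.[y])) ->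
  L2inner v b = polyint (v1 * b1) * polyint (v2 * b2) +
                polyint (v3 * b3) * polyint (v4 * b4).
Proof.
move=> vE bE; rewrite /L2inner.
transitivity (\int[(lebesgue_measure \x lebesgue_measure)%E]_(z in @square R)
    ((v1 * b1).[z.1] * (v2 * b2).[z.2] + (v3 * b3).[z.1] * (v4 * b4).[z.2])).
  apply: eq_Rintegral => -[x y]; rewrite inE /square /= => -[]/=.
  rewrite !in_itv/= => /andP[x1 _] /andP[y1 _].
  by rewrite vE// bE !hornerM /=; ring.
rewrite RintegralD.
- by rewrite !Rintegral_tensor//; exact: integrable_horner.
- exact: measurableX.
- by apply: integrable_tensor => //; exact: integrable_horner.
- by apply: integrable_tensor => //; exact: integrable_horner.
Qed.

Section biorthogonality.
Variables (R : realType) (p : nat).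
Implicit Types (s t : family_index).

(** The coefficients (e1, e2) and the indices (i, j) for which the v-function is
    (e1 L_(i-1)(x) Lhat_j(y), e2 Lhat_i(x) L_(j-1)(y)) on the square. The members
    of the third family have index 1 in the variable on which they do not depend,
    since L_0 = 1, and coefficient 0 on the other component. *)
Definition v_data s : (R * R) * (nat * nat) :=
  match s with
  | TypeI i j => ((1, 1), (i, j))
  | TypeII i j => ((1, -1), (i, j))
  | TypeIII i => if (i <= p)%N then ((1, 0), (1%N, i))
                 else ((0, -1), ((i - p)%N, 1%N))
  end.

(** The coefficients (f1, f2) and the indices (k, l) for which the b-function is
    (f1 L_(k-1)(x) P_(l-2)(y), f2 P_(k-2)(x) L_(l-1)(y)), with P_n = P_n^(1,1).
    An index 1 occurs in l - 2 or k - 2, truncated to 0, only with coefficient 0. *)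
Definition b_data s : (R * R) * (nat * nat) :=
  match s with
  | TypeI k l => ((alpha R l k, alpha R k l), (k, l))
  | TypeII k l => ((alpha R l k, - alpha R k l), (k, l))
  | TypeIII l => if (l <= p)%N then ((1, 0), (1%N, l))
                 else ((0, 1), ((l - p)%N, 1%N))
  end.

(** The inner product of L_(i-1)(x) Lhat_j(y) with L_(k-1)(x) P_(l-2)(y) on the
    square, where P_n = P_n^(1,1). *)
Definition pairing i j k l : R :=
  polyint (legendre R i.-1 * legendre R k.-1) *
  polyint (int_legendre_poly R j * jacobi R 1 1 (l - 2)).

Lemma legendre0 : legendre R 0 = 1.
Proof.
have := mul_w_jacobi R 0 0.
by rewrite !expr0 mul1r /legendre => ->; rewrite expn0 mul1n invr1 scale1r.
Qed.

Lemma L2inner_pairing s t : index_in p s -> index_in p t ->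
  L2inner (v_fun p s) (b_fun (R := R) p t) =
  (let: ((e1, e2), (i, j)) := v_data s in
   let: ((f1, f2), (k, l)) := b_data t in
   e1 * f1 * pairing i j k l + e2 * f2 * pairing j i l k).
Proof.
move=> hs ht.
case vd : (v_data s) => [[e1 e2] [i j]]; case bd : (b_data t) => [[f1 f2] [k l]].
rewrite (@L2inner_horner _ _ _
  (e1 *: legendre R i.-1) (int_legendre_poly R j)
  (e2 *: int_legendre_poly R i) (legendre R j.-1)
  (f1 *: legendre R k.-1) (jacobi R 1 1 (l - 2))
  (f2 *: jacobi R 1 1 (k - 2)) (legendre R l.-1)).
- by rewrite /pairing !polyintZZ; ring.
- move=> x y x1 y1; rewrite (hornerZ e1) (hornerZ e2).
  case: s hs vd => [i' j'|i' j'|i'] /=.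
  + move=> /andP[/andP[hi _] /andP[hj _]] [<- <- <- <-].
    by rewrite !mul1r !int_legendreE.
  + move=> /andP[/andP[hi _] /andP[hj _]] [<- <- <- <-].
    by rewrite !mul1r !int_legendreE// mulN1r mulNr.
  + case: ifPn => [ip hi [<- <- <- <-]|ip hi [<- <- <- <-]].
      by rewrite int_legendreE ?legendre0 ?hornerC ?mul1r ?mul0r//; lia.
    by rewrite int_legendreE ?legendre0 ?hornerC ?mulr1 ?mulN1r ?mul0r//; lia.
- move=> x y; rewrite !hornerZ.
  case: t ht bd => [k' l'|k' l'|k'] /=.
  + by move=> _ [<- <- <- <-]; rewrite /lincomb /= !mulr0 addr0 add0r !mulrA.
  + by move=> _ [<- <- <- <-]; rewrite /lincomb /= !mulr0 addr0 add0r !mulrA.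
  + case: ifPn => _ _ [<- <- <- <-]; rewrite /btilde_I /btilde_II /=.
      by rewrite mul1r !mul0r.
    by rewrite mul1r !mul0r.
Qed.

Lemma twice_sub1_neq0 n : (0 < n)%N -> 2 * n%:R - 1 != 0 :> R.
Proof.
(* for a successor, interval inference finds the sign *)
by case: n.
Qed.

Lemma alpha_neq0 k l : (0 < k)%N -> (0 < l)%N -> alpha R k l != 0.
Proof.
move=> k0 l0.
by rewrite /alpha !mulf_neq0 ?invr_eq0 ?pnatr_eq0 ?twice_sub1_neq0 -?lt0n.
Qed.

Lemma pairingE i j k l : (0 < i)%N -> (0 < k)%N -> (2 <= j)%N -> (2 <= l)%N ->
  pairing i j k l = - ((i == k) && (j == l))%:R / alpha R l k.
Proof.
move=> i0 k0 j2 l2; rewrite /pairing legendre_moment int_legendre_moment//.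
have -> : (i.-1 == k.-1) = (i == k) by apply/eqP/eqP; lia.
case: eqP => _ /=; last by rewrite !mul0r oppr0 mul0r.
case: eqP => _ /=; last by rewrite !mul0r mulr0 oppr0 mul0r.
have -> : 2 * k.-1%:R + 1 = 2 * k%:R - 1 :> R.
  by rewrite -[in RHS](prednK k0) -[k.-1.+1%:R]natr1; ring.
have l0 : (0 < l)%N by lia.
have lR0 : l%:R != 0 :> R by rewrite pnatr_eq0 -lt0n.
by rewrite /alpha; field; rewrite lR0 !twice_sub1_neq0.
Qed.

Lemma alpha_pairing i j k l :
  (0 < i)%N -> (0 < k)%N -> (2 <= j)%N -> (2 <= l)%N ->
  alpha R l k * pairing i j k l = - ((i == k) && (j == l))%:R.
Proof.
move=> i0 k0 j2 l2; rewrite pairingE// mulrC divfK// alpha_neq0//; lia.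
Qed.

Lemma pairing_neq i j k l : (0 < i)%N -> (0 < k)%N -> i != k ->
  pairing i j k l = 0.
Proof.
move=> i0 k0 ik; rewrite /pairing legendre_moment.
by rewrite (_ : (i.-1 == k.-1) = false) ?mul0r//; apply/eqP; lia.
Qed.

(** Biorthogonality of a pair of functions from an inner product that is a
    nonzero multiple of the indicator of their indices being equal. *)
Lemma kronecker_reading (P : Prop) (b : bool) (c r : R) :
  (P <-> b) -> c != 0 -> r = c * b%:R -> (~ P -> r = 0) /\ (P -> r <> 0).
Proof.
move=> Pb c0 ->; split=> [nP|/Pb ->]; last by rewrite mulr1; exact/eqP.
by case: b Pb => [[_ /(_ isT)]//|_]; rewrite mulr0.
Qed.

End biorthogonality.

Theorem lemma4p4 (R : realType) (p : nat) (hp : (2 <= p)%N)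
    (s t : family_index) (hs : index_in p s) (ht : index_in p t) :
  (s <> t -> L2inner (v_fun p s) (b_fun (R := R) p t) = 0) /\
  (s = t -> L2inner (v_fun p s) (b_fun (R := R) p t) <> 0).
Proof.
have N2 : (-2 : R) != 0 by rewrite oppr_eq0 pnatr_eq0.
have andP2 (a b a' b' : nat) : a = a' /\ b = b' <-> (a == a') && (b == b').
  by split=> [[-> ->]|/andP[/eqP -> /eqP ->]]; rewrite ?eqxx.
have zero (P : Prop) (r : R) : ~ P -> r = 0 -> (~ P -> r = 0) /\ (P -> r <> 0).
  by [].
have simp := (@mul0r R, @mulr0 R, @mul1r R, @mulr1 R, @mulN1r R, @addr0 R,
  @add0r R).
rewrite (L2inner_pairing R hs ht).
case: s hs => [i j|i j|i] /= hs; case: t ht => [k l|k l|k] /= ht.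
- apply: (@kronecker_reading R _ ((i == k) && (j == l)) (- 2)) => //.
    by rewrite -andP2; split=> [[]|[-> ->]].
  rewrite !mul1r !alpha_pairing; try lia.
  by rewrite [(j == l) && _]andbC; ring.
- apply: zero => //; rewrite mul1r mulrN mulNr mul1r !alpha_pairing; try lia.
  by rewrite andbC subrr.
- case: ifPn => kp /=; apply: zero => //.
    by rewrite !simp pairing_neq ?(mulr0, oppr0)//; lia.
  by rewrite !simp pairing_neq ?(mulr0, oppr0)//; lia.
- apply: zero => //; rewrite mul1r mulN1r mulNr !alpha_pairing; try lia.
  by rewrite andbC subrr.
- apply: (@kronecker_reading R _ ((i == k) && (j == l)) (- 2)) => //.
    by rewrite -andP2; split=> [[]|[-> ->]].
  rewrite mul1r mulrNN mul1r !alpha_pairing; try lia.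
  by rewrite [(j == l) && _]andbC; ring.
- case: ifPn => kp /=; apply: zero => //.
    by rewrite !simp pairing_neq ?(mulr0, oppr0)//; lia.
  by rewrite !simp pairing_neq ?(mulr0, oppr0)//; lia.
- case: ifPn => ip /=; apply: zero => //.
    by rewrite !simp pairing_neq ?(mulr0, oppr0)//; lia.
  by rewrite !simp pairing_neq ?(mulr0, oppr0)//; lia.
- case: ifPn => ip /=; apply: zero => //.
    by rewrite !simp pairing_neq ?(mulr0, oppr0)//; lia.
  by rewrite !simp pairing_neq ?(mulr0, oppr0)//; lia.
- case: ifPn => ip; case: ifPn => kp /=.
  + apply: (@kronecker_reading R _ (i == k) (- (alpha R k 1)^-1)).
    * by split=> [[->]|/eqP ->].
    * by rewrite oppr_eq0 invr_eq0 alpha_neq0//; lia.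
    * by rewrite !mul0r addr0 !mul1r pairingE//; [rewrite mulNr mulrC mulNr|lia..].
  + by apply: zero; [case=> ik; lia|rewrite mulr0 !mul0r addr0].
  + by apply: zero; [case=> ik; lia|rewrite mulr0 !mul0r addr0].
  + apply: (@kronecker_reading R _ (i == k) (alpha R (k - p) 1)^-1).
    * by split=> [[->]|/eqP ->].
    * by rewrite invr_eq0 alpha_neq0//; lia.
    * have -> : (i == k) = (i - p == k - p)%N by apply/eqP/eqP; lia.
      rewrite !mul0r add0r mulr1 mulN1r pairingE//; [|lia..].
      by rewrite mulNr opprK mulrC.
Qed.
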